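(* Let $P\subseteq M_{\mathbb R}$ be a $d$-dimensional terminal Fano polytope. Then $$|\partial P\cap M|=|\mathcal V(P)|\le 2^{d+1}-2.$$ If equality holds, then $P$ is centrally symmetric. Equality holds for the terminal reflexive $d$-dimensional standard lattice zonotope $\mathcal Z_d:=\mathrm{conv}(\pm[0,1]^d)$ (with lattice $\mathbb Z^d$).
   Context: Let $M\cong\mathbb Z^d$ be a lattice, $M_{\mathbb R}=M\otimes\mathbb R$. A terminal Fano polytope is a $d$-dimensional lattice polytope $P\subseteq M_{\mathbb R}$ (vertices in $M$) with $0\in\mathrm{int}\,P$ and $P\cap M=\{0\}\cup\mathcal V(P)$, where $\mathcal V(P)$ is the set of vertices. $\partial P$ is the boundary. $P$ is centrally symmetric if $P=-P$. $P$ is reflexive if its dual $P^*=\{y:\langle x,y\rangle\ge -1\ \forall x\in P\}$ is a lattice polytope with respect to the dual lattice. $\pm[0,1]^d$ means $[0,1]^d\cup(-[0,1]^d)$. *)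

(* Defs.v *)
From HB Require Import structures.
From mathcomp Require Import all_boot all_order all_algebra.
From mathcomp Require Import all_classical all_reals all_analysis.

Set Implicit Arguments.
Unset Strict Implicit.
Unset Printing Implicit Defensive.

Import Order.TTheory GRing.Theory Num.Theory.
Import numFieldNormedType.Exports.

Local Open Scope classical_set_scope.
Local Open Scope ring_scope.

Section Polytopes.
Context {R : realType} {V : lmodType R}.
Implicit Types (A P : set V).

Definition convex_hull A : set V := smallest (@convex_set R V) A.

Definition polytope P := exists2 S : set V, finite_set S & P = convex_hull S.

(* The vertices are the 0-dimensional faces: the points at which some linear
   form attains its minimum over P, and at no other point of P. *)
Definition vertices P : set V :=
  [set v | P v /\ exists f : {linear V -> R^o},
     forall x, P x -> x <> v -> f v < f x].

Definition lattice_polytope (M : set V) P := polytope P /\ vertices P `<=` M.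

Definition centrally_symmetric P := P = [set - x | x in P].

Definition minkowski_sum n (A : 'I_n -> set V) : set V :=
  [set \sum_i x i | x in [set x : 'I_n -> V | forall i, A i (x i)]].

Definition lattice_zonotope (M : set V) P :=
  exists n (a b : 'I_n -> V), [/\ forall i, M (a i), forall i, M (b i)
    & P = minkowski_sum (fun i => convex_hull [set a i; b i])].

End Polytopes.

(* M_R is R^d, written as row vectors; the dual space is written as column
   vectors, with pairing <x, y> = x *m y. *)
Section Lattices.
Context {R : realType} {d : nat}.
Implicit Types (M P : set 'rV[R]_d).

Definition Zlattice : set 'rV[R]_d := [set x | forall j, x 0 j \is a Num.int].

(* M is the set of integral combinations of the rows of an invertible matrix,
   i.e. of some basis of R^d: a lattice of rank d that spans R^d. *)
Definition is_lattice M :=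
  exists2 B : 'M[R]_d, B \in unitmx & M = [set z *m B | z in Zlattice].

Definition pairing (x : 'rV[R]_d) (y : 'cV[R]_d) : R := (x *m y) 0 0.

Definition dual_lattice M : set 'cV[R]_d :=
  [set y | forall x, M x -> pairing x y \is a Num.int].

Definition dual_polytope P : set 'cV[R]_d :=
  [set y | forall x, P x -> -1 <= pairing x y].

Definition reflexive_polytope M P :=
  lattice_polytope (dual_lattice M) (dual_polytope P).

Definition boundary P : set 'rV[R]_d := closure P `\` interior P.

(* That P has dimension d is implied by 0 lying in its interior in R^d. *)
Definition terminal_Fano M P :=
  [/\ lattice_polytope M P, interior P 0 & P `&` M = [set 0] `|` vertices P].

Definition unit_cube : set 'rV[R]_d := [set x | forall j, 0 <= x 0 j <= 1].

End Lattices.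

Arguments Zlattice R d : clear implicits.
Arguments unit_cube R d : clear implicits.

Definition standard_zonotope (R : realType) (d : nat) : set 'rV[R]_d :=
  convex_hull (unit_cube R d `|` [set - x | x in unit_cube R d]).

Arguments standard_zonotope R d : clear implicits.

(* Main.v *)
Require Import Defs.
From HB Require Import structures.
From mathcomp Require Import all_boot all_order all_algebra.
From mathcomp Require Import all_classical all_reals all_analysis.
From mathcomp Require Import ring lra zify.

(** Why the theorem is true.

    The bound is Minkowski's parity argument. If two distinct vertices v, w of
    a terminal Fano polytope P are congruent modulo 2M, their midpoint is a
    lattice point of P that is not a vertex, hence it is 0 and w = -v
    (half_point). For the same reason no vertex v lies in 2M: the midpoint of 0
    and v would have to be 0, while 0 is interior. So each of the 2^d - 1
    nonzero classes of M/2M contains at most two vertices, which gives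
    2 (2^d - 1) = 2^(d+1) - 2. If this number is attained, every class that
    contains v also contains a second vertex, which must be -v; the vertex set
    is then symmetric, and so is P, being the convex hull of its vertices.

    Vertices are defined here as exposed points, so that the last fact
    (hull_of_vertices), like the closedness of P, rests on the separation of a
    point from the convex hull of a finite set. Separation is proved
    algebraically, from Gordan's alternative, by induction on the number of
    points.

    For the standard zonotope Z everything follows from its description by
    inequalities: |x_i| <= 1 and x_i - x_j <= 1 (zonotopeP). Its integral points
    are 0 and the vectors 1_A, -1_A for A nonempty; each 1_A is the unique
    maximum on Z of a sum of d of the defining forms, so these points are the
    vertices, and there are 2 (2^d - 1) of them. The same inequalities say that
    Z is the polar of the set of vectors e_i, -e_i, e_i - e_j, and by the bipolar
    argument the dual of Z is the convex hull of these vectors, which are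
    integral. Finally Z is the sum of the segments [0, e_i] and
    [0, -(1, ..., 1)]. *)

Set Implicit Arguments.
Unset Strict Implicit.
Unset Printing Implicit Defensive.

Import Order.TTheory GRing.Theory Num.Theory.
Import numFieldNormedType.Exports.

Local Open Scope classical_set_scope.
Local Open Scope card_scope.
Local Open Scope ring_scope.

(** * Convex hulls and exposed points *)

Section Averages.
Context {R : realFieldType}.
Implicit Types a b c t : R.

Lemma avg_ge a b c t :
  0 <= t <= 1 -> a <= b -> a <= c -> a <= t * b + (1 - t) * c.
Proof.
move=> /andP[t0 t1] ab ac.
have : 0 <= t * (b - a) by rewrite mulr_ge0// subr_ge0.
have : 0 <= (1 - t) * (c - a) by rewrite mulr_ge0// subr_ge0.
by lra.
Qed.

Lemma avg_gt a b c t :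
  0 <= t <= 1 -> a < b -> a < c -> a < t * b + (1 - t) * c.
Proof.
move=> t01 ab ac; apply: (@lt_le_trans _ _ (Num.min b c)).
  by rewrite lt_min ab.
by apply: avg_ge => //; rewrite ge_min lexx ?orbT.
Qed.

End Averages.

Section ConvexHull.
Context {R : realType} {V : lmodType R}.
Implicit Types (A B P S : set V) (x y v w : V).

Lemma convex_setP A : convex_set A <->
  (forall x y (t : R), 0 <= t <= 1 -> A x -> A y -> A (t *: x + (1 - t) *: y)).
Proof.
split=> [cA x y t /andP[t0 t1] Ax Ay|cA x y l /set_mem Ax /set_mem Ay].
  by have /set_mem := cA x y (Itv01 t0 t1) (mem_set Ax) (mem_set Ay).
by apply: mem_set; apply: cA => //; apply/andP; split.
Qed.

Lemma convex_hull_convex A : convex_set (convex_hull A).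
Proof.
apply/convex_setP => x y t t01 Ax Ay B [/= cB AB].
by apply: (convex_setP B).1 => //; [apply: Ax|apply: Ay].
Qed.

Lemma sub_convex_hull A : A `<=` convex_hull A.
Proof. exact: sub_gen_smallest. Qed.

Lemma convex_hull_sub A B : convex_set B -> A `<=` B -> convex_hull A `<=` B.
Proof. exact: smallest_sub. Qed.

Lemma convex_hull_avg A x y (t : R) : 0 <= t <= 1 ->
  convex_hull A x -> convex_hull A y -> convex_hull A (t *: x + (1 - t) *: y).
Proof. exact: (convex_setP _).1 (@convex_hull_convex A) x y t. Qed.

Lemma linear_avg (f : {linear V -> R^o}) t x y :
  f (t *: x + (1 - t) *: y) = t * f x + (1 - t) * f y :> R.
Proof. by rewrite linearD !linearZ. Qed.

Lemma convex_halfspace (f : {linear V -> R^o}) (a : R) :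
  convex_set [set x | a <= f x].
Proof.
apply/convex_setP => x y t t01 /= ax ay.
by rewrite linear_avg; apply: avg_ge.
Qed.

Lemma convex_opp A : convex_set A -> convex_set [set x | A (- x)].
Proof.
move=> /convex_setP cA; apply/convex_setP => x y t t01 /= Ax Ay.
by rewrite opprD -!scalerN; exact: cA.
Qed.

Lemma image_oppP A x : [set - z | z in A] x <-> A (- x).
Proof.
split=> [[z Az <-]|Ax]; first by rewrite opprK.
by exists (- x) => //; rewrite opprK.
Qed.

Lemma convex_hull_opp A : (forall x, A x -> A (- x)) ->
  centrally_symmetric (convex_hull A).
Proof.
move=> Aopp.
have hullN x : convex_hull A x -> convex_hull A (- x).
  apply: (convex_hull_sub (B := [set x | convex_hull A (- x)])).
    exact/convex_opp/convex_hull_convex.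
  by move=> y Ay; apply: sub_convex_hull; exact: Aopp.
apply/seteqP; split=> x; first by move=> Px; apply/image_oppP; exact: hullN.
by move=> /image_oppP/hullN; rewrite opprK.
Qed.

(** Convexity of this set is what turns strict minimality of s among finitely
    many generators into strict minimality over their whole convex hull. *)
Lemma convex_above_or_eq (f : {linear V -> R^o}) s :
  convex_set [set x | x = s \/ f s < f x].
Proof.
apply/convex_setP => x y t t01 /=.
have [->|t0] := eqVneq t 0; first by rewrite scale0r add0r subr0 scale1r.
have [->|t1] := eqVneq t 1; first by rewrite subrr scale0r addr0 scale1r.
have tgt0 : 0 < t by rewrite lt_neqAle eq_sym t0; case/andP: t01.
have tlt1 : t < 1 by rewrite lt_neqAle t1; case/andP: t01.
rewrite linear_avg; set a := f s; case=> [->|fx]; case=> [->|fy].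
- by left; rewrite -scalerDl addrC subrK scale1r.
- right; rewrite -/a; suff: a < t * a + (1 - t) * f y by [].
  by move: (f y : R) (a : R) fy; clear -tgt0 tlt1; move=> b c; nra.
- right; rewrite -/a; suff: a < t * f x + (1 - t) * a by [].
  by move: (f x : R) (a : R) fx; clear -tgt0 tlt1; move=> b c; nra.
- by right; exact: avg_gt.
Qed.

(** If v is not a generator, the form exposing v is larger than f v at every
    generator, hence on the whole hull, hence at v itself. *)
Lemma vertices_hull_sub S : vertices (convex_hull S) `<=` S.
Proof.
move=> v [Sv [f fv]]; apply: contrapT => NSv.
suff sub : convex_hull S `<=` [set x | f v < f x].
  by have := sub _ Sv; rewrite /= ltxx.
apply: convex_hull_sub => [|s Ss].
  apply/convex_setP => x y t t01 /= ax ay.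
  by rewrite linear_avg; apply: avg_gt.
by apply: fv; [exact: sub_convex_hull|move=> sv; apply: NSv; rewrite -sv].
Qed.

(** A linear form takes at the midpoint v the mean of its values at x and y, so
    it cannot be larger at both. *)
Lemma vertex_not_between P v x y : P x -> P y -> x <> y -> x + y = 2 *: v ->
  ~ vertices P v.
Proof.
move=> Px Py xy xyE [Pv [f fv]].
have fE : f x + f y = 2 * f v by rewrite -linearD xyE linearZ.
have [xv|xv] := pselect (x = v).
  apply: xy; rewrite xv; move: xyE; rewrite xv scaler_nat mulr2n.
  by move=> /addrI ->.
have [yv|yv] := pselect (y = v).
  apply: xy; rewrite yv; move: xyE; rewrite yv scaler_nat mulr2n.
  by move=> /addIr ->.
have := fv _ Px xv; have := fv _ Py yv; lra.
Qed.

Lemma vertices_opp P v : centrally_symmetric P -> vertices P v ->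
  vertices P (- v).
Proof.
move=> PN [Pv [f fv]].
have oppP x : P x -> P (- x) by rewrite {2}PN => Px; exists x.
split; first exact: oppP.
exists (f \o -%R)%FUN => x Px xv /=.
rewrite opprK; apply: fv; first exact: oppP.
by move=> xE; apply: xv; rewrite -xE opprK.
Qed.

End ConvexHull.

(** * Separation from the hull of finitely many points *)

Section Separation.
Context {R : realType} {m n : nat}.
Implicit Types (x y t : 'M[R]_(m, n)) (c : 'M[R]_(n, m)).

(** The linear forms on matrices; stated for all shapes, so that separation
    applies both to row vectors (points) and to column vectors (the dual). *)
Definition trace_form c : 'M[R]_(m, n) -> R^o := fun x => \tr (x *m c).

Lemma trace_form_is_linear c : linear (trace_form c).
Proof.
by move=> a x y; rewrite /trace_form mulmxDl -scalemxAl linearD linearZ.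
Qed.

HB.instance Definition _ c :=
  GRing.isLinear.Build R 'M[R]_(m, n) R^o _ (trace_form c)
    (trace_form_is_linear c).

Lemma trace_formDZ c b a x :
  trace_form (c + a *: b) x = trace_form c x + a * trace_form b x.
Proof. by rewrite /trace_form mulmxDr -scalemxAr linearD linearZ. Qed.

Lemma trace_form_tr_gt0 x : x != 0 -> 0 < trace_form x^T x.
Proof.
move=> x_neq0; have [i [j xij]] : exists i j, x i j != 0.
  apply: contrapT => x0; move/eqP: x_neq0; apply; apply/matrixP => i j.
  rewrite mxE; apply: contrapT => /eqP xij.
  by apply: x0; exists i, j.
have sqE : trace_form x^T x = \sum_i \sum_j x i j ^+ 2.
  by apply: eq_bigr => k _; rewrite mxE; apply: eq_bigr => l _; rewrite mxE.
have sq_ge0 k : 0 <= \sum_l x k l ^+ 2 by apply: sumr_ge0 => l _; exact: sqr_ge0.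
rewrite sqE (bigD1 i)//= (bigD1 j)//=.
rewrite -addrA ltr_wpDr ?exprn_even_gt0//.
by rewrite addr_ge0// sumr_ge0// => *; rewrite sqr_ge0.
Qed.

(** A perturbation of finitely many strict inequalities by a small enough
    multiple of f keeps them strict. *)
Lemma small_multiple (I : eqType) (s : seq I) (f g : I -> R) :
  (forall i, i \in s -> 0 < g i) ->
  exists2 e : R, 0 < e & forall i, i \in s -> e * f i < g i.
Proof.
elim: s => [|i s IHs] gs; first by exists 1.
have [|e e0 es] := IHs; first by move=> j js; apply: gs; rewrite inE js orbT.
have gi : 0 < g i by apply: gs; rewrite inE eqxx.
have fi1 : 0 < `|f i| + 1 by rewrite ltr_wpDl.
exists (Num.min e (g i / (`|f i| + 1))); first by rewrite lt_min e0 divr_gt0.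
move=> j; rewrite inE; set d := Num.min _ _.
have d0 : 0 < d by rewrite lt_min e0 divr_gt0.
case/predU1P => [->|js].
  have : d * (`|f i| + 1) <= g i by rewrite -ler_pdivlMr// ge_min lexx orbT.
  have := ler_norm (f i); nra.
have [fj|fj] := leP (f j) 0.
  apply: (@le_lt_trans _ _ 0); first by rewrite mulr_ge0_le0// ltW.
  by apply: gs; rewrite inE js orbT.
apply: le_lt_trans (es _ js); rewrite ler_pM2r// ge_min lexx //.
Qed.

(** Gordan's alternative: the finite set s lies in an open half-space unless its
    conic hull reaches 0. By induction there is a form c positive on s; it remains
    to treat one more point t. If c t = 0, tilt c slightly towards t. If c t < 0,
    push each point of s along t into the kernel of c. The pushed points are
    positive combinations of s and t, so the induction hypothesis for them gives
    a form b; then b', which equals b on that kernel and vanishes at t, is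
    positive on s, and tilting it slightly by - c makes it positive at t too.
    The cone K is kept abstract, so that the pushed points stay in the same K. *)
Lemma gordan (K : set 'M[R]_(m, n)) (s : seq 'M[R]_(m, n)) :
    (forall x y, K x -> K y -> K (x + y)) ->
    (forall a x, 0 < a -> K x -> K (a *: x)) ->
    ~ K 0 -> (forall x, x \in s -> K x) ->
  exists c, forall x, x \in s -> 0 < trace_form c x.
Proof.
move=> KD KZ K0.
(* Induction on the size, since the hypothesis is also used for the pushed
   points, which do not form a sublist of s. *)
have [k] := ubnP (size s).
elim: k s => // k IHk [|t s] /= sk Ks; first by exists 0.
have Kt : K t by apply: Ks; rewrite inE eqxx.
have {}Ks x : x \in s -> K x by move=> xs; apply: Ks; rewrite inE xs orbT.
have [c cs] := IHk s sk Ks.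
have [ct|ct|ct] := ltgtP (trace_form c t) 0; last first.
- have t0 : t != 0 by apply: contra_notN K0 => /eqP <-.
  have [e e0 es] := small_multiple (fun x => - trace_form t^T x) cs.
  exists (c + e *: t^T) => x; rewrite trace_formDZ inE.
  case/predU1P => [->|xs]; first by rewrite ct add0r mulr_gt0// trace_form_tr_gt0.
  by have := es _ xs; rewrite mulrN; lra.
- by exists c => x; rewrite inE => /predU1P[->//|]; exact: cs.
(* p is the projection along t onto the kernel of c. *)
pose p x := x - (trace_form c x / trace_form c t) *: t.
have [||b bs] := IHk [seq p x | x <- s]; first by rewrite size_map.
  move=> _ /mapP[x xs ->]; rewrite /p -scaleNr; apply: KD; first exact: Ks.
  apply: KZ => //; rewrite oppr_gt0 pmulr_rlt0 ?invr_lt0//; exact: cs.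
pose b' := b + (- (trace_form b t / trace_form c t)) *: c.
have b't : trace_form b' t = 0.
  by rewrite trace_formDZ mulNr divfK ?subrr// lt_eqF.
have b's x : x \in s -> 0 < trace_form b' x.
  move=> xs; have := bs _ (map_f p xs).
  rewrite /p linearB linearZ /= trace_formDZ.
  set u := trace_form b x; set v := trace_form b t; set w := trace_form c x.
  suff -> : u + - (v / trace_form c t) * w = u - (w / trace_form c t) * v by [].
  by ring.
have [e e0 es] := small_multiple (fun x => trace_form c x) b's.
exists (b' + (- e) *: c) => x; rewrite trace_formDZ inE mulNr.
case/predU1P => [->|xs]; last by rewrite subr_gt0; exact: es.
by rewrite b't sub0r oppr_gt0 pmulr_rlt0.
Qed.

(** Gordan's alternative for the directions from x to the points of S; the cone
    is generated by the directions from x to the hull of S, and avoids 0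
    exactly because x is outside this hull. *)
Lemma separation (S : set 'M[R]_(m, n)) x :
    finite_set S -> ~ convex_hull S x ->
  exists c a, trace_form c x < a /\ forall y, S y -> a < trace_form c y.
Proof.
move=> /finite_seqP[s ->] Nx.
pose K := [set l *: (y - x) | l in [set l : R | 0 < l] & y in convex_hull [set` s]].
have [||||c cs] := @gordan K [seq y - x | y <- s].
- move=> _ _ [a /= a0 [y Sy <-]] [b /= b0 [z Sz <-]].
  have ab0 : 0 < a + b by rewrite addr_gt0.
  exists (a + b) => //.
  (* The sum of the two multiples is a + b times a weighted mean of y and z. *)
  pose t := a / (a + b).
  have tE : (a + b) * t = a by rewrite /t mulrC divfK// gt_eqF.
  exists (t *: y + (1 - t) *: z).
    apply: convex_hull_avg => //.
    apply/andP; split; first by rewrite divr_ge0// ltW.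
    by rewrite /t ler_pdivrMr// mul1r lerDl ltW.
  have tE' : (a + b) * (1 - t) = b by rewrite mulrBr mulr1 tE addrAC subrr add0r.
  by rewrite !scalerBr scalerDr !scalerA tE tE' scalerDl opprD addrACA.
- move=> a _ a0 [b /= b0 [y Sy <-]]; exists (a * b); first exact: mulr_gt0.
  by exists y => //; rewrite scalerA.
- move=> [a /= a0 [y Sy /eqP]]; rewrite scaler_eq0 gt_eqF//= subr_eq0 => /eqP yx.
  by apply: Nx; rewrite -yx.
- move=> _ /mapP[y ys ->]; exists 1; first exact: ltr01.
  by exists y; [exact: sub_convex_hull|rewrite scale1r].
have cs' y : y \in s -> 0 < trace_form c y - trace_form c x.
  by move=> ys; rewrite -linearB; apply: cs; exact: map_f.
have [e e0 es] := small_multiple (fun=> 1) cs'.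
exists c, (trace_form c x + e); split; first by rewrite ltrDl.
by move=> y /es; rewrite mulr1 ltrBrDl.
Qed.

(** A generator that is not a vertex lies in the hull of the others, since a form
    separating it from them would expose it. Such generators can therefore be
    discarded one at a time until only vertices are left. *)
Lemma hull_of_vertices (S : set 'M[R]_(m, n)) : finite_set S ->
  convex_hull S = convex_hull (vertices (convex_hull S)).
Proof.
move=> /finite_seqP[s ->]; have [k] := ubnP (size s).
elim: k s => // k IHk s sk; apply/seteqP; split; last first.
  by apply: convex_hull_sub; [exact: convex_hull_convex|move=> x []].
have [sv|] := pselect ([set` s] `<=` vertices (convex_hull [set` s])).
  apply: convex_hull_sub; first exact: convex_hull_convex.
  by move=> x /sv; exact: sub_convex_hull.
move=> /existsNP[t /not_implyP[/= ts tv]].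
pose s' := [seq x <- s | x != t].
have s's : [set` s'] `<=` [set` s] by move=> x /=; rewrite mem_filter => /andP[].
have ts' : convex_hull [set` s'] t.
  apply: contrapT => /(separation (finite_seq s'))[c [a [ta as']]].
  apply: tv; split; first exact: sub_convex_hull.
  exists (trace_form c) => x sx xt.
  suff sub : convex_hull [set` s] `<=`
      [set y | y = t \/ trace_form c t < trace_form c y].
    by case: (sub _ sx).
  apply: convex_hull_sub; first exact: convex_above_or_eq.
  move=> y ys; have [->|yt] := eqVneq y t; [by left|right].
  by apply: lt_trans ta _; apply: as'; rewrite /= mem_filter yt.
have ss' : convex_hull [set` s] = convex_hull [set` s'].
  apply/seteqP; split; apply: convex_hull_sub; try exact: convex_hull_convex.
    move=> y ys; have [->//|yt] := eqVneq y t.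
    by apply: sub_convex_hull; rewrite /= mem_filter yt.
  by move=> y /s's; exact: sub_convex_hull.
rewrite ss' -IHk//; apply: leq_trans (_ : (size s <= k)%N) => //.
rewrite size_filter.
rewrite -(count_predC (pred1 t) s) -[X in (X < _)%N]add0n ltn_add2r.
by rewrite -has_count has_pred1.
Qed.

End Separation.

(** * Topology of polytopes *)

Section Topology.
Context {R : realType} {d : nat}.
Implicit Types (P S : set 'rV[R]_d) (v x : 'rV[R]_d).

Lemma trace_form_continuous (c : 'cV[R]_d) :
  continuous (trace_form c : 'rV[R]_d -> R^o).
Proof.
have -> : trace_form c = fun x : 'rV[R]_d => \sum_i (x 0 i * c i 0 : R^o).
  by apply/funext => x; rewrite /trace_form /mxtrace big_ord1 mxE.
move=> x; apply: (@cvg_big _ _ _ _ _ _ _ (nbhs x)) => [|i _].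
  exact: add_continuous.
by apply: cvgMl; exact: coord_continuous.
Qed.

Lemma closed_convex_hull S : finite_set S -> closed (convex_hull S).
Proof.
move=> finS x clx; apply: contrapT => /(separation finS)[c [a [xa aS]]].
have sub : convex_hull S `<=` [set y | a <= trace_form c y].
  apply: convex_hull_sub; first exact: convex_halfspace.
  by move=> y /aS/ltW.
have : [set y | a <= trace_form c y] x.
  have /closure_id -> : closed [set y : 'rV[R]_d | a <= trace_form c y].
    apply: (closed_comp (f := trace_form c) (D := [set r : R^o | a <= r])).
      by move=> y _; exact: trace_form_continuous.
    exact: closed_ge.
  exact: closure_subset clx.
by rewrite /= leNgt xa.
Qed.

Lemma nbhs_shift P v : nbhs v P ->
  exists2 e, 0 < e & forall x, (forall j, `|x 0 j| < e) -> P (v + x).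
Proof.
move=> /nbhs_ballP[e /= e0 eP]; exists e => // x xe.
apply: eP; split=> // i j; rewrite ord1 mxE /ball /= opprD addNKr.
by rewrite normrN.
Qed.

(** An interior point is the midpoint of a small segment inside P. *)
Lemma vertex_not_interior P v : (0 < d)%N -> vertices P v -> ~ interior P v.
Proof.
move=> d0 vP /nbhs_shift[e e0 eP].
pose u : 'rV[R]_d := const_mx (e / 2).
have u0 : u != 0.
  apply/eqP => /matrixP/(_ 0 (Ordinal d0)); rewrite !mxE => /eqP.
  by rewrite gt_eqF// divr_gt0.
have ue j : `|u 0 j| < e by rewrite mxE gtr0_norm ?divr_gt0//; lra.
apply: (@vertex_not_between _ _ P v (v + u) (v + - u)) => //; first exact: eP.
- by apply: eP => j; rewrite mxE normrN.
- move/addrI/eqP; rewrite -subr_eq0 opprK -mulr2n -scaler_nat scaler_eq0.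
  by rewrite pnatr_eq0/= (negbTE u0).
- by rewrite addrACA subrr addr0 scaler_nat mulr2n.
Qed.

End Topology.

(** * Counting *)

Section Cardinality.

Lemma card_finset (T : finType) (F : {set T}) : [set` F] #= `I_#|F|.
Proof.
have -> : [set` F] = @enum_val T (mem F) @` [set: 'I_#|F|].
  apply/seteqP; split=> x /= => [xF|[i _ <-]]; last exact: enum_valP.
  by exists (enum_rank_in xF x) => //; rewrite enum_rankK_in.
apply: card_eq_trans (card_esym card_II).
by apply: inj_card_eq => i j _ _; exact: enum_val_inj.
Qed.

(** Labels for a pair (nonzero class modulo 2, sign): the targets of the injection
    that bounds the number of vertices. *)
Definition signed_classes d : {set {set 'I_d} * bool} :=
  [set p | p.1 != finset.set0].

Lemma card_signed_classes d : #|signed_classes d| = (2 ^ d.+1 - 2)%N.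
Proof.
have -> : signed_classes d = finset.setX [set~ finset.set0]%SET [set: bool]%SET.
  by apply/setP => -[A b]; rewrite !inE andbT.
rewrite cardsX cardsT card_bool cardsC1 -cardsT -powersetT card_powerset.
by rewrite cardsT card_ord expnS; lia.
Qed.

(** An injection between finite sets of the same cardinality is onto: omitting p
    would leave room for one element less. *)
Lemma inj_eq_card_surj (T : choiceType) (U : finType) (A : set T)
    (F : {set U}) (g : T -> U) (p : U) :
    {in A &, injective g} -> g @` A `<=` [set` F] -> A #= `I_#|F| -> p \in F ->
  exists2 x, A x & g x = p.
Proof.
move=> ginj gF AF pF; apply: contrapT => Np.
have : `I_#|F| #<= `I_#|F :\ p|.
  rewrite -(card_le_eql AF) -(card_le_eqr (card_finset _)).
  rewrite -(card_le_eql (inj_card_eq ginj)).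
  apply: subset_card_le => _ [x Ax <-] /=.
  rewrite !inE; apply/andP; split; last by apply: gF; exists x.
  by apply/eqP => gx; apply: Np; exists x.
by rewrite card_le_II (cardsD1 p F) pF add1n ltnn.
Qed.

End Cardinality.

(** * Lattice points of a terminal Fano polytope *)

Section Bound.
Context {R : realType} {d : nat}.
Implicit Types (M P : set 'rV[R]_d) (v w : 'rV[R]_d).

(** The class of v in M/2M, where M is spanned by the rows of B: the set of
    indices of the odd coordinates of v in this basis. *)
Definition parity_class (B : 'M[R]_d) v : {set 'I_d} :=
  [set j | (v *m invmx B) 0 j / 2 \isn't a Num.int].

Lemma int_half_add (a b : R) : a \is a Num.int -> b \is a Num.int ->
  (a / 2 \is a Num.int) = (b / 2 \is a Num.int) -> (a + b) / 2 \is a Num.int.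
Proof.
move=> /intrP[m ->] /intrP[n ->].
have halfE k : ((k%:~R / 2 : R) \is a Num.int) = (2 %| k)%Z.
  apply/intrP/dvdzP => -[q qE]; exists q.
    apply: (intr_inj (R := R)); rewrite intrM -qE divfK//.
  by rewrite qE intrM mulfK.
by rewrite -intrD !halfE; lia.
Qed.

Lemma parity_class_half B v w :
    B \in unitmx -> [set z *m B | z in Zlattice R d] v ->
    [set z *m B | z in Zlattice R d] w ->
    parity_class B v = parity_class B w ->
  [set z *m B | z in Zlattice R d] (2^-1 *: (v + w)).
Proof.
move=> uB [y yZ <-] [z zZ <-]; rewrite /parity_class !mulmxK// => /setP yz.
exists (2^-1 *: (y + z)); last by rewrite -scalemxAl mulmxDl.
move=> j; rewrite !mxE mulrC; apply: int_half_add => //.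
by have := yz j; rewrite !inE => /negb_inj.
Qed.

Context (M P : set 'rV[R]_d) (B : 'M[R]_d).
Context (d_gt0 : (0 < d)%N) (uB : B \in unitmx)
  (ME : M = [set z *m B | z in Zlattice R d]) (PF : terminal_Fano M P).

Lemma terminal_Fano_convex : convex_set P.
Proof. by case: PF => -[[S _ ->] _] _ _; exact: convex_hull_convex. Qed.

Lemma terminal_Fano0 : P 0.
Proof. by case: PF => _ P0 _; exact: interior_subset. Qed.

Lemma terminal_Fano_vertex v : vertices P v -> [/\ P v, M v & v != 0].
Proof.
move=> vP; case: PF => _ P0 PM.
have [Pv Mv] : (P `&` M) v by rewrite PM; right.
split=> //; apply: contra_not_neq (vertex_not_interior d_gt0 vP) => ->.
exact: P0.
Qed.

Lemma terminal_Fano_lattice_point v : P v -> M v -> v = 0 \/ vertices P v.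
Proof.
move=> Pv Mv; case: PF => _ _ PM.
by have : (P `&` M) v by []; rewrite PM => -[->|]; [left|right].
Qed.

(** The midpoint of v and w is a lattice point of P which is not a vertex, so it
    is 0. *)
Lemma half_point v w : P v -> P w -> M v -> M w -> v <> w ->
  parity_class B v = parity_class B w -> w = - v.
Proof.
move=> Pv Pw Mv Mw vw cvw; pose m := 2^-1 *: (v + w).
have m2 : v + w = 2 *: m by rewrite scalerA divff// scale1r.
have Mm : M m by rewrite ME; apply: parity_class_half; rewrite -?ME.
have Pm : P m.
  have -> : m = 2^-1 *: v + (1 - 2^-1) *: w.
    by rewrite /m scalerDr; congr (_ + _ *: _); lra.
  by apply: (convex_setP P).1 terminal_Fano_convex _ _ _ _ Pv Pw; lra.
have [m0|/(vertex_not_between Pv Pw vw m2)//] := terminal_Fano_lattice_point Pm Mm.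
by apply/eqP; rewrite -addr_eq0 addrC m2 m0 scaler0.
Qed.

(** Otherwise half_point applies to v and 0, and gives v = 0. *)
Lemma parity_class_vertex_neq0 v : vertices P v ->
  parity_class B v != finset.set0.
Proof.
move=> vP; have [Pv Mv v0] := terminal_Fano_vertex vP.
have M0 : M 0 by rewrite ME; exists 0; [move=> j; rewrite mxE|rewrite mul0mx].
apply: contra_neq v0 => cv; apply: contrapT => v0.
have c0 : parity_class B v = parity_class B 0.
  by rewrite cv; apply/esym/setP => j; rewrite !inE mul0mx mxE mul0r int_num0.
have /esym/eqP := half_point Pv terminal_Fano0 Mv M0 v0 c0.
by rewrite oppr_eq0 => /eqP.
Qed.

(** The second component tells v from -v: choose picks one of the two points,
    and it picks the same one whether it is started from v or from -v. *)
Definition signed_class v : {set 'I_d} * bool :=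
  (parity_class B v, v == choose (pred2 v (- v)) v).

Lemma signed_class_inj : {in vertices P &, injective signed_class}.
Proof.
move=> v w /set_mem vP /set_mem wP [cvw].
have [Pv Mv _] := terminal_Fano_vertex vP.
have [Pw Mw _] := terminal_Fano_vertex wP.
apply: contra_eq => /eqP vw.
have wE : w = - v by exact: half_point.
have -> : choose (pred2 w (- w)) w = choose (pred2 v (- v)) v.
  rewrite wE opprK.
  have /eq_choose -> : pred2 (- v) v =1 pred2 v (- v) by move=> x /=; rewrite orbC.
  by apply: choose_id; rewrite /= eqxx ?orbT.
have : pred2 v (- v) (choose (pred2 v (- v)) v) by apply: chooseP; rewrite /= eqxx.
have /negbTE vwF : v != w by apply/eqP.
have wvF : (w == v) = false by rewrite eq_sym.
by rewrite /= -wE => /pred2P[->|->]; rewrite eqxx ?vwF ?wvF.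
Qed.

Lemma signed_class_sub : signed_class @` vertices P `<=` [set` signed_classes d].
Proof.
by move=> _ [v vP <-]; rewrite /= inE /=; exact: parity_class_vertex_neq0.
Qed.

Lemma card_vertices_le : vertices P #<= `I_(2 ^ d.+1 - 2)%N.
Proof.
rewrite -card_signed_classes -(card_le_eqr (card_finset _)).
rewrite -(card_le_eql (inj_card_eq signed_class_inj)).
exact: subset_card_le signed_class_sub.
Qed.

(** When all labels are taken, the label of v with the other sign belongs to a
    vertex w in the class of v, and w = -v by half_point. *)
Lemma card_vertices_eq_symmetric :
  vertices P #= `I_(2 ^ d.+1 - 2)%N -> centrally_symmetric P.
Proof.
rewrite -card_signed_classes => Pcard.
have vN v : vertices P v -> vertices P (- v).
  move=> vP; have [Pv Mv _] := terminal_Fano_vertex vP.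
  have [||w wP [cw bw]] := @inj_eq_card_surj _ _ _ _ _
    (parity_class B v, ~~ (v == choose (pred2 v (- v)) v))
    signed_class_inj signed_class_sub => //.
    by rewrite inE /=; exact: parity_class_vertex_neq0.
  have [Pw Mw _] := terminal_Fano_vertex wP.
  rewrite -(@half_point v w)// => vw; move: bw; rewrite -vw.
  by case: eqP.
case: PF => -[[S finS PE] _] _ _.
rewrite PE hull_of_vertices// -PE; exact: convex_hull_opp.
Qed.

Lemma boundary_lattice_points : boundary P `&` M = vertices P.
Proof.
have clP : closure P = P.
  case: PF => -[[S finS ->] _] _ _.
  by rewrite -((closure_id _).1 (closed_convex_hull finS)).
rewrite /boundary clP; apply/seteqP; split=> v.
  move=> [[Pv Piv] Mv]; case: (terminal_Fano_lattice_point Pv Mv) => // v0.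
  by case: Piv; rewrite v0; case: PF.
move=> vP; have [Pv Mv _] := terminal_Fano_vertex vP.
by split=> //; split=> //; exact: vertex_not_interior.
Qed.

End Bound.

(** * The standard zonotope *)

Section Zonotope.
Context {R : realType} {d : nat}.
Implicit Types (x y : 'rV[R]_d) (A : {set 'I_d}) (p : {set 'I_d} * bool).
Local Notation Z := (standard_zonotope R d).

Definition indicator A : 'rV[R]_d := \row_j (j \in A)%:R.

Lemma bool_bound (b : bool) : 0 <= (b%:R : R) <= 1.
Proof. by case: b; rewrite ?lexx ?ler01. Qed.

(** By induction on the number of coordinates other than 0 and 1: x is a mean of
    the two points obtained by replacing one such coordinate by 0 and by 1. *)
Lemma unit_cube_hull (C : set 'rV[R]_d) : convex_set C ->
  (forall A, C (indicator A)) -> unit_cube R d `<=` C.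
Proof.
move=> /convex_setP cC CI x.
pose U x := [set j | x 0 j != (x 0 j == 1)%:R]%SET.
have bool_eq1 (b : bool) : (b%:R : R) == (b%:R == 1 :> R)%:R.
  by case: b; rewrite ?eqxx// [0 == 1]eq_sym oner_eq0 eqxx.
have [k] := ubnP #|U x|; elim: k x => // k IHk x Uk xcube.
have [U0|[j jU]] := set_0Vmem (U x).
  have -> : x = indicator [set j | x 0 j == 1]%SET; last exact: CI.
  apply/rowP => j; rewrite mxE inE; apply/eqP.
  by move/setP/(_ j): U0; rewrite !inE => /negbFE.
pose y (b : bool) : 'rV[R]_d := \row_i (if i == j then b%:R else x 0 i).
have yE : x = x 0 j *: y true + (1 - x 0 j) *: y false.
  by apply/rowP => i; rewrite !mxE; case: eqP => [->|_] /=; ring.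
have Cy b : C (y b).
  apply: IHk => [|i]; last first.
    by rewrite mxE; case: eqP => _; [exact: bool_bound|exact: xcube].
  apply: leq_trans (proper_card _) (Uk : (#|U x| <= k)%N).
  apply/properP; split; last first.
    by exists j => //; rewrite inE mxE eqxx; exact/negPn/bool_eq1.
  apply/fintype.subsetP => i; rewrite !inE mxE; case: (eqVneq i j) => _; last by [].
  by rewrite bool_eq1.
by rewrite yE; apply: cC.
Qed.

Definition zonotope_ineq x :=
  (forall i, `|x 0 i| <= 1) /\ forall i j, x 0 i - x 0 j <= 1.

Lemma zonotope_ineq_convex : convex_set zonotope_ineq.
Proof.
apply/convex_setP => x y t /andP[t0 t1] [x1 x2] [y1 y2]; split=> [i|i j].
  rewrite !mxE (le_trans (ler_normD _ _))// !normrM.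
  rewrite (ger0_norm t0) (@ger0_norm _ (1 - t)) ?subr_ge0//.
  have := x1 i; have := y1 i; nra.
rewrite !mxE; have := x2 i j; have := y2 i j; nra.
Qed.

(** The least t such that x + t (1, ..., 1) is nonnegative works: t is either 0 or
    some - x_k, so that x_j + t <= 1 is one of the inequalities. *)
Lemma zonotope_coordinates x : zonotope_ineq x ->
  exists t (u : 'I_d -> R), [/\ 0 <= t <= 1, forall j, 0 <= u j <= 1
    & forall j, x 0 j = u j - t].
Proof.
move=> [x1 x2]; have xle j : -1 <= x 0 j <= 1 by rewrite -ler_norml.
pose t := \big[Num.max/0]_j (- x 0 j).
have t_ge j : - x 0 j <= t by exact: le_bigmax.
have t_le b : 0 <= b -> (forall j, - x 0 j <= b) -> t <= b.
  by move=> b0 xb; apply: bigmax_le.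
exists t, (fun j => x 0 j + t); split=> [|j|j]; last by rewrite addrK.
  apply/andP; split; first exact: bigmax_ge_id.
  by apply: t_le => // j; rewrite lerNl; case/andP: (xle j).
have : t <= 1 - x 0 j.
  apply: t_le => [|i]; first by have := xle j; lra.
  have := x2 j i; lra.
by have := t_ge j; lra.
Qed.

(** For the converse inclusion, write x = u - t (1, ..., 1) with u in the cube. The
    positive part of x has entries at most 1 - t and its negative part entries at
    most t, so x is the mean with weights 1 - t and t of a point of the cube
    and of a point of its opposite. *)
Lemma zonotopeP x : Z x <-> zonotope_ineq x.
Proof.
split.
  move: x; apply: convex_hull_sub; first exact: zonotope_ineq_convex.
  move=> x [x01|[y y01 <-]]; split=> [i|i j]; rewrite ?mxE.
  - by rewrite ler_norml; have := x01 i; lra.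
  - by have := x01 i; have := x01 j; lra.
  - by rewrite ler_norml; have := y01 i; lra.
  - by have := y01 i; have := y01 j; lra.
move=> /zonotope_coordinates[t [u [t01 u01 xE]]].
have divcube (w : 'rV[R]_d) a : 0 <= a -> (forall j, 0 <= w 0 j <= a) ->
    unit_cube R d (a^-1 *: w) /\ a *: (a^-1 *: w) = w.
  move=> a0 wa; have [a_eq0|a_neq0] := eqVneq a 0.
    have -> : w = 0.
      apply/rowP => j; rewrite mxE; have := wa j; rewrite a_eq0.
      by move=> /andP[w0 w1]; apply/eqP; rewrite eq_le w0 w1.
    by rewrite !scaler0; split=> // j; rewrite mxE lexx ler01.
  have agt0 : 0 < a by rewrite lt_neqAle eq_sym a_neq0.
  rewrite scalerA divff// scale1r; split=> // j; rewrite mxE mulrC.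
  rewrite ler_pdivrMr// mul1r; case/andP: (wa j) => w0 ->.
  by rewrite divr_ge0.
(* The positive and the negative part of x. *)
pose q : 'rV[R]_d := \row_j Num.max (x 0 j) 0.
pose r : 'rV[R]_d := \row_j Num.max (- x 0 j) 0.
have [||q01 qE] := divcube q (1 - t); first by lra.
  move=> j; rewrite mxE le_max lexx orbT/= ge_max xE; have := u01 j.
  by move=> ?; apply/andP; split; lra.
have [||r01 rE] := divcube r t; first by lra.
  move=> j; rewrite mxE le_max lexx orbT/= ge_max xE; have := u01 j.
  by move=> ?; apply/andP; split; lra.
have -> : x = (1 - t) *: ((1 - t)^-1 *: q) + (1 - (1 - t)) *: - (t^-1 *: r).
  rewrite qE subKr scalerN rE; apply/rowP => j; rewrite !mxE.
  by rewrite !maxEle oppr_le0; case: (leP (x 0 j)); case: (leP 0 (x 0 j)); lra.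
apply: convex_hull_avg; first lra.
  by apply: sub_convex_hull; left.
by apply: sub_convex_hull; right; exists (t^-1 *: r).
Qed.

Definition signed_indicator p : 'rV[R]_d :=
  if p.2 then indicator p.1 else - indicator p.1.

Lemma zonotope_ineq_opp x : zonotope_ineq x -> zonotope_ineq (- x).
Proof.
move=> [x1 x2]; split=> [i|i j]; rewrite !mxE ?normrN//.
by rewrite opprK addrC.
Qed.

Lemma zonotope_symmetric : centrally_symmetric Z.
Proof.
apply/seteqP; split=> x.
  move=> /zonotopeP xZ; apply/image_oppP; apply/zonotopeP.
  exact: zonotope_ineq_opp.
move=> /image_oppP/zonotopeP/zonotope_ineq_opp; rewrite opprK.
by move=> xZ; apply/zonotopeP.
Qed.

Lemma zonotope_indicator A : zonotope_ineq (indicator A).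
Proof.
split=> [i|i j]; rewrite !mxE.
  by rewrite normr_nat; case/andP: (bool_bound (i \in A)).
by have := bool_bound (i \in A); have := bool_bound (j \in A); lra.
Qed.

Lemma zonotope_signed_indicator p : Z (signed_indicator p).
Proof.
apply/zonotopeP; rewrite /signed_indicator; case: p.2.
  exact: zonotope_indicator.
exact/zonotope_ineq_opp/zonotope_indicator.
Qed.

Lemma zonotope_hull : Z = convex_hull (range signed_indicator).
Proof.
apply/seteqP; split; apply: convex_hull_sub; try exact: convex_hull_convex; last first.
  by move=> _ [p _ <-]; exact: zonotope_signed_indicator.
have hullI p : convex_hull (range signed_indicator) (signed_indicator p).
  by apply: sub_convex_hull; exists p.
move=> x [x01|[y y01 <-]].
  apply: unit_cube_hull x01 => [|A]; first exact: convex_hull_convex.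
  exact: hullI (A, true).
move: y01; apply: (unit_cube_hull (C := [set y | convex_hull _ (- y)])).
  exact/convex_opp/convex_hull_convex.
by move=> A; exact: hullI (A, false).
Qed.

Lemma zonotope_polytope : polytope Z.
Proof.
exists (range signed_indicator); last exact: zonotope_hull.
exact: finite_image.
Qed.

Lemma zonotope_interior0 : interior Z 0.
Proof.
apply/nbhs_ballP; exists (2^-1); first by rewrite /= invr_gt0.
move=> x [_ x2]; apply/zonotopeP.
have xlt i : - 2^-1 < x 0 i < 2^-1.
  by rewrite -ltr_norml; have := x2 0 i; rewrite /ball /= mxE sub0r normrN.
split=> [i|i j]; first by rewrite ler_norml; have := xlt i; lra.
by have := xlt i; have := xlt j; lra.
Qed.

(** For a in A, a sum of d of the forms -x_j and x_j - x_a, each at least -1 on the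
    zonotope; the value -1 of all of them characterizes the indicator of A. *)
Definition indicator_form A a : 'rV[R]_d -> R^o :=
  fun x => \sum_j (if j \in A then - x 0 j else x 0 j - x 0 a).

Lemma indicator_form_is_linear A a : linear (indicator_form A a).
Proof.
move=> k x y; rewrite /indicator_form scaler_sumr -big_split.
apply: eq_bigr => j _; rewrite !mxE /= /GRing.scale /=.
by case: ifP => _; ring.
Qed.

HB.instance Definition _ A a := GRing.isLinear.Build R 'rV[R]_d R^o _
  (indicator_form A a) (indicator_form_is_linear A a).

Lemma indicator_vertex A : A != finset.set0 -> vertices Z (indicator A).
Proof.
move=> /set0Pn[a aA]; split; first exact: zonotope_signed_indicator (A, true).
exists (indicator_form A a) => x /zonotopeP[x1 x2] xA.
have termI j : (if j \in A then - indicator A 0 j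
    else indicator A 0 j - indicator A 0 a) = -1.
  by rewrite !mxE aA; case: (j \in A); rewrite /= ?sub0r.
have term_ge j : -1 <= (if j \in A then - x 0 j else x 0 j - x 0 a).
  case: ifP => _; last by have := x2 a j; lra.
  by rewrite lerN2 (le_trans (ler_norm _)).
suff : (indicator_form A a (indicator A) : R) < indicator_form A a x by [].
have -> : indicator_form A a (indicator A) = \sum_(j < d) (-1 : R).
  by apply: eq_bigr => j _; exact: termI.
rewrite lt_neqAle /indicator_form.
rewrite ler_sum// andbT; apply/eqP => /esym/eqP.
rewrite -subr_eq0 -sumrB psumr_eq0 => [/allP x_eq|j _]; last by rewrite subr_ge0.
apply: xA; apply/rowP => j; rewrite mxE.
have {}x_eq i : (if i \in A then - x 0 i else x 0 i - x 0 a) = -1.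
  by apply/eqP; rewrite -subr_eq0; apply: (implyP (x_eq i _)).
have xa : x 0 a = 1 by have := x_eq a; rewrite aA; lra.
by have := x_eq j; case: ifP => _ /=; rewrite ?xa; lra.
Qed.

Lemma zonotope_not_vertex0 : (0 < d)%N -> ~ vertices Z 0.
Proof. by move=> d0 /vertex_not_interior; apply=> //; exact: zonotope_interior0. Qed.

Lemma indicator0 : indicator finset.set0 = 0.
Proof. by apply/rowP => j; rewrite !mxE inE. Qed.

(** Indicators and their opposites generate the zonotope, so they are the only
    candidates, and 0 is excluded as an interior point. *)
Lemma zonotope_vertices : (0 < d)%N ->
  vertices Z = signed_indicator @` [set` signed_classes d].
Proof.
move=> d0; apply/seteqP; split=> v.
  move=> vZ; have [[A b] _ vE] : range signed_indicator v.
    by move: vZ; rewrite zonotope_hull; exact: vertices_hull_sub.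
  exists (A, b) => //; rewrite /= inE /=; apply/eqP => A0.
  apply: (zonotope_not_vertex0 d0); move: vZ; rewrite -vE /signed_indicator A0 /=.
  by rewrite indicator0 oppr0 if_same.
move=> [[A b] /=]; rewrite inE /= => A0 <-.
rewrite /signed_indicator /=; case: b; first exact: indicator_vertex.
exact/vertices_opp/indicator_vertex/A0/zonotope_symmetric.
Qed.

Lemma signed_indicator_inj :
  {in [set` signed_classes d] &, injective signed_indicator}.
Proof.
have ind_inj A A' : indicator A = indicator A' -> A = A'.
  move=> /rowP AA'; apply/setP => j; have := AA' j; rewrite !mxE => /eqP.
  by rewrite eqr_nat; case: (j \in A); case: (j \in A').
have ind_opp A A' : A != finset.set0 -> indicator A = - indicator A' -> False.
  move=> /set0Pn[j jA] /rowP/(_ j); rewrite !mxE jA /= => jE.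
  have := bool_bound (j \in A'); lra.
move=> [A b] [A' b'] /set_mem AS /set_mem AS'.
have A0 : A != finset.set0 by move: AS; rewrite /= inE.
have A0' : A' != finset.set0 by move: AS'; rewrite /= inE.
rewrite /signed_indicator /= {AS AS'}; case: b; case: b' => //.
- by move/ind_inj => ->.
- by move/(ind_opp _ _ A0).
- by move/esym/(ind_opp _ _ A0').
- by move/oppr_inj/ind_inj => ->.
Qed.

Lemma card_zonotope_vertices : (0 < d)%N ->
  vertices Z #= `I_(2 ^ d.+1 - 2)%N.
Proof.
move=> d0; rewrite zonotope_vertices// -card_signed_classes.
exact: card_eq_trans (inj_card_eq signed_indicator_inj) (card_finset _).
Qed.

Lemma signed_indicator_lattice p : Zlattice R d (signed_indicator p).
Proof.
by move=> j; rewrite /signed_indicator; case: p.2; rewrite !mxE ?rpredN rpred_nat_num.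
Qed.

(** Coordinates of opposite signs would differ by at least 2, so an integral
    point of the zonotope is a nonnegative or nonpositive vector with
    coordinates of absolute value at most 1. *)
Lemma zonotope_lattice_point x : Z x -> Zlattice R d x ->
  exists p, x = signed_indicator p.
Proof.
have nonneg y : zonotope_ineq y -> Zlattice R d y -> (forall j, 0 <= y 0 j) ->
    y = indicator [set j | y 0 j == 1]%SET.
  move=> [y1 _] yZ y0; apply/rowP => j; rewrite mxE inE.
  have := y0 j; have := y1 j; case/intrP: (yZ j) => k ->.
  move=> k1 k0; have k_ge0 : (0 <= k)%R by rewrite -(ler_int R).
  have k_le1 : (k <= 1)%R by rewrite -(ler_int R) (le_trans (ler_norm _)).
  have [->|->] : k = 0 \/ k = 1 by lia.
    by rewrite eq_sym oner_eq0.
  by rewrite eqxx.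
move=> /zonotopeP xZ xint.
have [x0|] := pselect (forall j, 0 <= x 0 j).
  by exists ([set j | x 0 j == 1]%SET, true); exact: nonneg.
move=> /existsNP[i /negP]; rewrite -ltNge => xi.
exists ([set j | (- x) 0 j == 1]%SET, false).
rewrite /signed_indicator /= -nonneg ?opprK//.
- exact: zonotope_ineq_opp.
- by move=> j; rewrite mxE rpredN.
move=> j; rewrite mxE oppr_ge0; have := xZ.2 j i.
move: xi; case/intrP: (xint i) => k ->; case/intrP: (xint j) => l ->.
rewrite (ltr_int R k 0) -intrB (ler_int R _ 1) (ler_int R _ 0); lia.
Qed.

Lemma zonotope_terminal_Fano : (0 < d)%N -> terminal_Fano (Zlattice R d) Z.
Proof.
move=> d0; have VZ : vertices Z `<=` Zlattice R d.
  by rewrite zonotope_vertices// => _ [p _ <-]; exact: signed_indicator_lattice.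
split; [by split; first exact: zonotope_polytope|exact: zonotope_interior0|].
apply/seteqP; split=> x; last first.
  move=> [->|xV]; last by split; [case: xV|exact: VZ].
  split; first exact: interior_subset zonotope_interior0.
  by move=> j; rewrite mxE int_num0.
move=> [xZ xint]; have [[A b] xE] := zonotope_lattice_point xZ xint.
have [A0|A0] := eqVneq A finset.set0; [left|right].
  by rewrite /= xE /signed_indicator /= A0 indicator0 oppr0 if_same.
by rewrite zonotope_vertices//; exists (A, b); rewrite //= inE.
Qed.

(** The normals of the facet inequalities of the zonotope, together with 0
    (from equal indices in the differences). *)
Definition roots : set 'cV[R]_d :=
  [set p.1 *: delta_mx p.2 0 | p in [set` [:: 1; -1]] `*` [set: 'I_d]] `|`
  range (fun p : 'I_d * 'I_d => delta_mx p.1 0 - delta_mx p.2 0).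

Lemma finite_roots : finite_set roots.
Proof.
rewrite finite_setU; split; apply: finite_image => //.
exact: finite_setX.
Qed.

Lemma pairing_delta x i : pairing x (delta_mx i 0) = x 0 i.
Proof. by rewrite /pairing -colE mxE. Qed.

Lemma pairingB x (y z : 'cV[R]_d) : pairing x (y - z) = pairing x y - pairing x z.
Proof. by rewrite /pairing mulmxBr !mxE. Qed.

Lemma pairingZ x a (y : 'cV[R]_d) : pairing x (a *: y) = a * pairing x y.
Proof. by rewrite /pairing -scalemxAr mxE. Qed.

Lemma zonotope_roots x : Z x <-> forall y : 'cV_d, roots y -> -1 <= pairing x y.
Proof.
split.
  move=> /zonotopeP[x1 x2] y [[[a i] [/= a1 _] <-]|[[i j] _ <-]] /=.
    rewrite pairingZ pairing_delta; have := x1 i; rewrite ler_norml.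
    by move: a1; rewrite !inE => /orP[]/eqP->; lra.
  by rewrite pairingB !pairing_delta; have := x2 j i; lra.
move=> xr; apply/zonotopeP; split=> [i|i j].
  have := xr (1 *: delta_mx i 0); have := xr (-1 *: delta_mx i 0).
  rewrite !pairingZ pairing_delta ler_norml => h1 h2.
  have {}h1 : -1 <= -1 * x 0 i.
    by apply: h1; left; exists (-1, i); rewrite //= !inE eqxx orbT.
  have {}h2 : -1 <= 1 * x 0 i.
    by apply: h2; left; exists (1, i); rewrite //= !inE eqxx.
  lra.
have := xr (delta_mx j 0 - delta_mx i 0); rewrite pairingB !pairing_delta => h.
suff : -1 <= x 0 j - x 0 i by lra.
by apply: h; right; exists (j, i).
Qed.

(** The bipolar argument: a form c separating y from the hull of the roots is
    bounded below on the roots by some a, and a < 0 because roots come in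
    opposite pairs. Rescaled by 1 / (- a), c becomes a point of the zonotope,
    at which y takes a value below -1. *)
Lemma zonotope_dual : (0 < d)%N -> dual_polytope Z = convex_hull roots.
Proof.
move=> d0; apply/seteqP; split; last first.
  apply: convex_hull_sub => [|y ry x /zonotope_roots]; last exact.
  apply/convex_setP => y z t t01 yZ zZ x xZ.
  have -> : pairing x (t *: y + (1 - t) *: z) =
      t * pairing x y + (1 - t) * pairing x z.
    by rewrite /pairing mulmxDr -!scalemxAr !mxE.
  by apply: avg_ge; [|exact: yZ|exact: zZ].
move=> y yZ; apply: contrapT => /(separation finite_roots)[c [a [ya ra]]].
have formE z : trace_form c z = pairing c z.
  by rewrite /trace_form /pairing mxtrace_mulC /mxtrace big_ord1.
rewrite formE in ya.
have a_lt0 : a < 0.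
  pose i := Ordinal d0.
  have := ra (1 *: delta_mx i 0); have := ra (-1 *: delta_mx i 0).
  rewrite !formE !pairingZ => h1 h2.
  have {}h1 : a < -1 * pairing c (delta_mx i 0).
    by apply: h1; left; exists (-1, i); rewrite //= !inE eqxx orbT.
  have {}h2 : a < 1 * pairing c (delta_mx i 0).
    by apply: h2; left; exists (1, i); rewrite //= !inE eqxx.
  lra.
have scaleE z : pairing ((- a)^-1 *: c) z = pairing c z / - a.
  by rewrite /pairing -scalemxAl mxE mulrC.
have : Z ((- a)^-1 *: c).
  apply/zonotope_roots => z /ra; rewrite formE scaleE => az.
  by rewrite ler_pdivlMr ?oppr_gt0// mulN1r opprK ltW.
move=> /yZ; rewrite scaleE ler_pdivlMr ?oppr_gt0// mulN1r opprK.
by rewrite leNgt ya.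
Qed.

Lemma zonotope_reflexive : (0 < d)%N -> reflexive_polytope (Zlattice R d) Z.
Proof.
move=> d0; rewrite /reflexive_polytope zonotope_dual//; split.
  by exists roots => //; exact: finite_roots.
move=> y /vertices_hull_sub ry x xint.
case: ry => [[[a i] [/= a1 _] <-]|[[i j] _ <-]] /=.
  rewrite pairingZ pairing_delta.
  by move: a1; rewrite !inE => /orP[]/eqP->; rewrite ?mul1r ?mulN1r ?rpredN.
by rewrite pairingB !pairing_delta rpredB.
Qed.

Lemma convex_hull_segment (b x : 'rV[R]_d) :
  convex_hull [set 0; b] x <-> exists2 t, 0 <= t <= 1 & x = t *: b.
Proof.
split.
  move: x; apply: convex_hull_sub => [|x [->|->]].
  - apply/convex_setP => x y t t01 [r r01 ->] [s s01 ->].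
    exists (t * r + (1 - t) * s); last by rewrite [RHS]scalerDl !scalerA.
    have /andP[r0 r1] := r01; have /andP[s0 s1] := s01.
    apply/andP; split; first exact: avg_ge.
    have /andP[t0 t1] := t01; nra.
  - by exists 0; rewrite ?scale0r// lexx ler01.
  - by exists 1; rewrite ?scale1r// lexx ler01.
move=> [t t01 ->].
have -> : t *: b = t *: b + (1 - t) *: 0 by rewrite scaler0 addr0.
by apply: convex_hull_avg => //; apply: sub_convex_hull; [right|left].
Qed.

(** The generators are the segments from 0 to e_j and from 0 to -(1, ..., 1), so the
    sum of the segments is the set of points u - t (1, ..., 1) with u in the cube
    and t in [0, 1]. *)
Lemma zonotope_lattice_zonotope : lattice_zonotope (Zlattice R d) Z.
Proof.
pose b (i : 'I_d.+1) : 'rV[R]_d :=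
  if unlift ord0 i is Some j then delta_mx 0 j else - const_mx 1.
have sumE (t : 'I_d.+1 -> R) j : (\sum_i t i *: b i) 0 j = t (lift ord0 j) - t ord0.
  rewrite summxE big_ord_recl (bigD1 j)//= big1 => [|i ij].
    by rewrite /b unlift_none liftK !mxE !eqxx /=; ring.
  by rewrite /b liftK !mxE eqxx /= eq_sym (negbTE ij) mulr0.
exists d.+1, (fun=> 0), b; split.
- by move=> i j; rewrite mxE int_num0.
- move=> i j; rewrite /b; case: unlift => [k|].
    by rewrite mxE rpred_nat_num.
  by rewrite !mxE rpredN int_num1.
apply/seteqP; split=> x.
  move=> /zonotopeP/zonotope_coordinates[t [u [t01 u01 xE]]].
  pose s i := if unlift ord0 i is Some j then u j else t.
  exists (fun i => s i *: b i).
    move=> i; apply/convex_hull_segment; exists (s i) => //.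
    by rewrite /s; case: unlift.
  by apply/rowP => j; rewrite sumE /s unlift_none liftK xE.
move=> [y yb <-]; apply/zonotopeP.
have /choice[t tP] : forall i, exists t, 0 <= t <= 1 /\ y i = t *: b i.
  by move=> i; have /convex_hull_segment[t t01 yE] := yb i; exists t.
under eq_bigr do rewrite (tP _).2.
have t01 i := (tP i).1.
split=> [i|i j]; rewrite !sumE.
  by rewrite ler_norml; have := t01 ord0; have := t01 (lift ord0 i); lra.
have := t01 ord0; have := t01 (lift ord0 i); have := t01 (lift ord0 j); lra.
Qed.

End Zonotope.

Theorem corollary6p3 (R : realType) (d : nat) (d_gt0 : (0 < d)%N) :
  (forall M P : set 'rV[R]_d, is_lattice M -> terminal_Fano M P ->
     [/\ boundary P `&` M #= vertices P,
         vertices P #<= `I_(2 ^ d.+1 - 2)%N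
       & vertices P #= `I_(2 ^ d.+1 - 2)%N -> centrally_symmetric P]) /\
  [/\ terminal_Fano (Zlattice R d) (standard_zonotope R d),
      reflexive_polytope (Zlattice R d) (standard_zonotope R d),
      lattice_zonotope (Zlattice R d) (standard_zonotope R d)
    & vertices (standard_zonotope R d) #= `I_(2 ^ d.+1 - 2)%N].
Proof.
split=> [M P [B uB ME] PF|].
  split; last exact: (card_vertices_eq_symmetric d_gt0 uB ME PF).
    by rewrite (boundary_lattice_points d_gt0 PF) card_eqxx.
  exact: (card_vertices_le d_gt0 uB ME PF).
split; [exact: zonotope_terminal_Fano|exact: zonotope_reflexive| |].
  exact: zonotope_lattice_zonotope.
exact: card_zonotope_vertices.
Qed.
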